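(* Every implementable allocation rule can be implemented by a menu containing a single signal. That is, if an allocation rule $a:V\to[0,1]\times\mathbb{R}$ arises in an equilibrium of the game induced by some menu $\mathcal{M}$ of signals, then there exists a signal $\hat{\mathcal{I}}$ such that $a$ arises in an equilibrium of the game induced by the menu $\{\hat{\mathcal{I}}\}$.
   Context: Setting. Fix reals $H>L>0$ and $V=\{L,H\}$. A seller's type $\theta\in\Theta\subseteq[0,1]$ is drawn from a probability measure $F$ on $[0,1]$ concentrated on $\Theta$; conditional on $\theta$, the buyer's value $v\in V$ equals $H$ with probability $\theta$ and $L$ with probability $1-\theta$ (so $\theta$ is the seller's belief that $v=H$). A signal $\mathcal{I}=(S,\pi)$ is a (measurable) set $S$ of realizations together with probability distributions $\pi(\cdot\mid v)$ on $S$, $v\in V$. A menu $\mathcal{M}$ is a set of signals. Game induced by $\mathcal{M}$: (1) nature draws $\theta\sim F$ and then $v$ according to $\theta$; (2) the seller privately observes $\theta$ and chooses a signal $\mathcal{I}=(S,\pi)\in\mathcal{M}$; (3) the seller observes $s\sim\pi(\cdot\mid v)$ (given $v$, the realization is independent of $\theta$) and posts a price $p\in\mathbb{R}$; (4) the buyer observes $v$ and $p$ and decides whether to buy. If trade occurs the buyer gets $v-p$ and the seller gets $p$; otherwise both get $0$. Equilibrium means perfect Bayesian equilibrium: the seller updates by Bayes' rule, her (possibly randomized) price maximizes her expected profit given her posterior, her (possibly randomized) choice of signal maximizes her expected profit given her type, and the buyer buys optimally. The buyer buys when indifferent, so with posterior probability $t$ of $v=H$ the seller's optimal price is $H$ if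 $t>L/H$, $L$ if $t<L/H$, and either one if $t=L/H$. An equilibrium induces an allocation rule $a:V\to[0,1]\times\mathbb{R}$, which gives, for each value $v$, the probability of trade and the expected payment from buyer to seller conditional on $v$. An allocation rule is implementable if it arises in an equilibrium of the game induced by some menu. *)

(* Defs.v *)
From HB Require Import structures.
From mathcomp Require Import all_boot all_order all_algebra.
From mathcomp Require Import all_classical all_reals all_analysis.
From mathcomp Require Import measurable_realfun.

Set Implicit Arguments.
Unset Strict Implicit.
Unset Printing Implicit Defensive.

Import Order.TTheory GRing.Theory Num.Theory.
Import numFieldNormedType.Exports.

Local Open Scope classical_set_scope.
Local Open Scope ring_scope.

Variant value := low | high.

Definition buyer_value (R : realType) (L H : R) (v : value) : R :=
  match v with low => L | high => H end.

(* Probability of [v] in the eyes of a seller of type [t]. *)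
Definition value_prob (R : realType) (t : R) (v : value) : R :=
  match v with low => 1 - t | high => t end.

Record signal (R : realType) := Signal {
  signal_display : measure_display ;
  realization : measurableType signal_display ;
  signal_dist : value -> probability realization R }.

Arguments Signal {R signal_display} realization signal_dist.

(* A set of signals, presented injectively by an index type. The sigma-algebra
   on the indices is arbitrary; it is there so that "a randomized choice of
   signal depending measurably on the type" is meaningful. *)
Record menu (R : realType) := Menu {
  menu_display : measure_display ;
  menu_index : measurableType menu_display ;
  menu_signal :> menu_index -> signal R ;
  menu_signal_inj : injective menu_signal }.

Arguments Menu {R menu_display} menu_index menu_signal _.

Lemma unit_fun_inj (T : Type) (x : T) : injective (fun _ : unit => x).
Proof. by move=> [] []. Qed.

Definition singleton_menu (R : realType) (I : signal R) : menu R :=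
  Menu unit (fun=> I) (unit_fun_inj (x := I)).

(* Strategies and beliefs:
   - [choice t] is the randomized choice of signal of type [t];
   - [pricing m (t, s)] is the randomized price posted by type [t] who chose
     the signal [m] and observed [s], and [belief m t s] the probability she
     then assigns to the value [high];
   - [buy v p] tells whether the buyer of value [v] accepts the price [p]. *)
Record assessment (R : realType) (M : menu R) := Assessment {
  choice : R.-pker (measurableTypeR R) ~> (menu_index M) ;
  pricing : forall m : menu_index M,
    R.-pker (measurableTypeR R * realization (M m)) ~> (measurableTypeR R) ;
  belief : forall m : menu_index M, R -> realization (M m) -> R ;
  buy : value -> R -> bool }.

Arguments belief {R M} _ m t s.

Section Outcomes.
Local Open Scope ereal_scope.
Context (R : realType) (M : menu R) (sigma : assessment M).

(* Expectation of [f price], given that type [t] chose [m] and the value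
   is [v]. *)
Definition expect_price (t : R) (m : menu_index M) (v : value)
    (f : R -> \bar R) : \bar R :=
  \int[signal_dist (M m) v]_s \int[pricing sigma m (t, s)]_p f p.

Definition trade_prob (t : R) (m : menu_index M) (v : value) : \bar R :=
  expect_price t m v (fun p => ((buy sigma v p)%:R)%:E).

Definition payment (t : R) (m : menu_index M) (v : value) : \bar R :=
  expect_price t m v (fun p => (p * (buy sigma v p)%:R)%:E).

Definition signal_profit (t : R) (m : menu_index M) : \bar R :=
  (value_prob t high)%:E * payment t m high
  + (value_prob t low)%:E * payment t m low.

Definition price_profit (b : R) (p : R) : R :=
  (value_prob b high * (p * (buy sigma high p)%:R)
   + value_prob b low * (p * (buy sigma low p)%:R))%R.

Definition price_dist (v : value) (A : set (measurableTypeR R))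
    (tm : measurableTypeR R * menu_index M) : \bar R :=
  \int[signal_dist (M tm.2) v]_s pricing sigma tm.2 (tm.1, s) A.

(* Joint measurability in the type and the chosen signal of the price
   distribution given each value, without which neither the expected profit from
   a randomized choice of signal nor the allocation is well defined. *)
Definition measurable_outcome (Theta : set R) : Prop :=
  forall (v : value) (A : set (measurableTypeR R)), measurable A ->
    measurable_fun ((Theta : set (measurableTypeR R)) `*` [set: menu_index M])
      (price_dist v A).

(* [belief] is a version of the conditional probability of [high] given the
   realization, after every choice of signal, on or off path. *)
Definition bayes_rule (Theta : set R) : Prop :=
  forall (t : R) (m : menu_index M), Theta t ->
  [/\ measurable_fun [set: realization (M m)]
        (belief sigma m t : _ -> measurableTypeR R),
      (forall s, 0 <= belief sigma m t s <= 1)%R &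
      forall A : set (realization (M m)), measurable A ->
        (value_prob t high)%:E *
          \int[signal_dist (M m) high]_(s in A) (belief sigma m t s)%:E +
        (value_prob t low)%:E *
          \int[signal_dist (M m) low]_(s in A) (belief sigma m t s)%:E
        = (value_prob t high)%:E * signal_dist (M m) high A].

Definition optimal_pricing (Theta : set R) : Prop :=
  forall (t : R) (m : menu_index M) (s : realization (M m)) (p' : R),
    Theta t ->
    (price_profit (belief sigma m t s) p')%:E <=
    \int[pricing sigma m (t, s)]_p (price_profit (belief sigma m t s) p)%:E.

Definition optimal_choice (Theta : set R) : Prop :=
  forall (t : R) (m' : menu_index M), Theta t ->
    signal_profit t m' <= \int[choice sigma t]_m signal_profit t m.

(* The buyer maximizes [(v - p) * buy], and buys when indifferent. *)
Definition optimal_buying (L H : R) : Prop :=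
  forall (v : value) (p : R),
    (forall b' : bool, (buyer_value L H v - p) * b'%:R <=
                       (buyer_value L H v - p) * (buy sigma v p)%:R)%R /\
    (p = buyer_value L H v -> buy sigma v p).

Definition equilibrium (L H : R) (Theta : set R) : Prop :=
  [/\ measurable_outcome Theta, bayes_rule Theta, optimal_pricing Theta,
      optimal_choice Theta & optimal_buying L H].

(* [a v] is the conditional expectation, given [v], of the pair (trade,
   payment). Multiplied out, so that [a v] is unconstrained when [v] has
   probability zero. *)
Definition induces (Theta : set R)
    (F : probability (measurableTypeR R) R) (a : value -> R * R) : Prop :=
  forall v : value,
    let prob_v := \int[F]_(t in Theta) (value_prob t v)%:E in
    (a v).1%:E * prob_v =
      \int[F]_(t in Theta) ((value_prob t v)%:E *
        \int[choice sigma t]_m trade_prob t m v) /\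
    (a v).2%:E * prob_v =
      \int[F]_(t in Theta) ((value_prob t v)%:E *
        \int[choice sigma t]_m payment t m v).

End Outcomes.

Definition allocation_rule (R : realType) (a : value -> R * R) : Prop :=
  forall v, 0 <= (a v).1 <= 1.

Definition implements (R : realType) (L H : R) (Theta : set R)
    (F : probability (measurableTypeR R) R) (M : menu R)
    (a : value -> R * R) : Prop :=
  exists sigma : assessment M,
    equilibrium sigma L H Theta /\ induces sigma Theta F a.

Definition implementable (R : realType) (L H : R) (Theta : set R)
    (F : probability (measurableTypeR R) R) (a : value -> R * R) : Prop :=
  exists M : menu R, implements L H Theta F M a.

(* Main.v *)
Require Import Defs.
From HB Require Import structures.
From mathcomp Require Import all_boot all_order all_algebra.
From mathcomp Require Import all_classical all_reals all_analysis.
From mathcomp Require Import measurable_realfun.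
From mathcomp Require Import ring lra.

(* In any equilibrium the seller charges [L] or [H], so a type [t] is described by
   the probabilities [q_v(t)] of charging [H] given the value [v]; her profit is
   [L + t (H - L) q_high(t) - (1 - t) L q_low(t)], affine in [t], and allocation
   and payments depend on [q] alone. Since any type may imitate another one's
   choice of signal and prices, or ignore her signal, [q] is incentive
   compatible and beats always charging [L] or always charging [H].
   Conversely, put [alpha = L - L q_low] and [beta = (H - L) q_high + L q_low].
   The concave conjugate [A] of the indirect profit satisfies [A beta(t) = alpha(t)]
   and has a monotone supergradient [x] on [0, H]. Draw [u] in [0, H] with density
   [(1 - x u) / (H - L)] if the value is high and [x u / L] if it is low. Then type
   [x u] is exactly indifferent at [u], so type [t] optimally charges [H] for
   [u < beta(t)] and [L] above, and since the integral of [x] over [0, beta(t)] is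
   [A 0 - A beta(t) = L q_low(t)], she charges [H] with the probabilities [q_v(t)]. *)

Set Implicit Arguments.
Unset Strict Implicit.
Unset Printing Implicit Defensive.

Import Order.TTheory GRing.Theory Num.Theory.
Import numFieldNormedType.Exports.

Local Open Scope classical_set_scope.
Local Open Scope ring_scope.

(** * Concave envelopes and their supergradients *)

(** Take for [x] minus the left derivative of [A] at [u], the supremum [sup S] of the rates of
    decline over intervals ending at [u]. Monotonicity and the Lipschitz bound place it in [0, 1].
    The inequality to the left of [u] is the definition of the supremum; to the right it is
    concavity at three points. *)
Lemma concave_supergradient (R : realType) (A : R -> R) :
  {homo A : u v / u <= v >-> v <= u} ->
  (forall u v, u <= v -> A u - A v <= v - u) ->
  (forall u v w, u <= v <= w -> (w - v) * A u + (v - u) * A w <= (w - u) * A v) ->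
  forall u, exists2 x, 0 <= x <= 1 & forall v, A v <= A u - x * (v - u).
Proof.
move=> Adecr Alip Aconc u.
pose S := [set (A v - A u) / (u - v) | v in [set v | v < u]].
have S1 : S ((A (u - 1) - A u) / (u - (u - 1))).
  by exists (u - 1) => //=; lra.
have Sub : ubound S 1.
  move=> _ [v /= vu <-]; rewrite ler_pdivrMr ?subr_gt0// mul1r.
  by apply: Alip; exact: ltW.
have Shs : has_sup S by split; [eexists; exact: S1|exists 1].
have Sle v : v < u -> (A v - A u) / (u - v) <= sup S.
  by move=> vu; apply: ub_le_sup; [exists 1|exists v].
exists (sup S).
  apply/andP; split; last by apply: ge_sup => //; eexists; exact: S1.
  apply: le_trans (ub_le_sup _ S1); last by exists 1.
  by rewrite divr_ge0 ?subr_ge0//; [apply: Adecr; lra | lra].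
move=> v; case: (ltgtP v u) => [vu|uv|->]; last by lra.
  have := Sle v vu; rewrite ler_pdivrMr ?subr_gt0//; lra.
suff : sup S <= (A u - A v) / (v - u).
  by rewrite ler_pdivlMr ?subr_gt0//; lra.
apply: ge_sup; first by eexists; exact: S1.
move=> _ [z /= zu <-].
rewrite ler_pdivrMr ?subr_gt0// mulrAC ler_pdivlMr ?subr_gt0//.
have /Aconc : z <= u <= v by rewrite !ltW.
lra.
Qed.

(* [A] is the concave conjugate of the upper envelope of the lines
   [t |-> alpha + t * beta]. *)
Lemma support_lines_envelope (R : realType) (P : R -> R -> R -> Prop) :
  (exists t alpha beta, P t alpha beta) ->
  (forall t alpha beta, P t alpha beta -> 0 <= t <= 1) ->
  (forall t alpha beta t' alpha' beta', P t alpha beta -> P t' alpha' beta' ->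
    alpha' + t * beta' <= alpha + t * beta) ->
  exists A x : R -> R,
    [/\ (forall u, 0 <= x u <= 1),
        (forall u v, A v <= A u - x u * (v - u)),
        (forall t alpha beta, P t alpha beta -> A beta = alpha) &
        (forall t alpha beta, P t alpha beta ->
           forall v, A v <= alpha - t * (v - beta))].
Proof.
move=> [t0 [a0 [b0 P0]]] P01 PP.
(* [K] is the epigraph over [0, 1] of the upper envelope of the lines in [P]. By [PP] each line
   touches the envelope at its own [t], which is [KP]. *)
pose K := [set ct : R * R | 0 <= ct.2 <= 1 /\
  forall t a b, P t a b -> a + ct.2 * b <= ct.1].
have KP t a b : P t a b -> K (a + t * b, t).
  by move=> Ptab; split=> /= [|t' a' b' P']; [exact: P01 Ptab|exact: PP Ptab P'].
pose S u := [set ct.1 - ct.2 * u | ct in K].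
pose A u := inf (S u).
have S0 u : S u !=set0 by eexists; eexists; [exact: KP P0|].
have Slb u : has_lbound (S u).
  (* Membership in [K] gives [c >= a0 + t * b0], so [c - t * u] is at least [a0 + t * (b0 - u)],
     with [t] in [0, 1]. *)
  exists (a0 - `|b0 - u|) => _ [[c t] [/= /andP[t_ge0 t_le1] /(_ _ _ _ P0) h] <-].
  have : - (t * (b0 - u)) <= `|b0 - u|.
    apply: le_trans (ler_norm _) _; rewrite normrN normrM ger0_norm//.
    by rewrite ler_piMl.
  lra.
have Ale u c t : K (c, t) -> A u <= c - t * u.
  by move=> Kct; apply: ge_inf => //; exists (c, t).
have leA u y : (forall c t, K (c, t) -> y <= c - t * u) -> y <= A u.
  by move=> h; apply: lb_le_inf => // _ [[c t] Kct <-]; exact: h.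
(* [A] is an infimum of affine functions with slopes [- t] in [-1, 0]; monotonicity, the Lipschitz
   bound and concavity are inherited from them. *)
have Adecr : {homo A : u v / u <= v >-> v <= u}.
  move=> u v uv; apply: leA => c t Kct; apply: le_trans (Ale _ _ _ Kct) _.
  by case: Kct => /= /andP[t_ge0 _] _; rewrite lerD2l lerN2 ler_wpM2l.
have Alip u v : u <= v -> A u - A v <= v - u.
  move=> uv; rewrite lerBlDr addrC -lerBlDr; apply: leA => c t Kct.
  have := Ale u _ _ Kct; case: Kct => /= /andP[t_ge0 t_le1] _.
  have : t * (v - u) <= v - u by rewrite ler_piMl ?subr_ge0.
  lra.
have Aconc u v w : u <= v <= w ->
    (w - v) * A u + (v - u) * A w <= (w - u) * A v.
  move=> /andP[uv vw]; have [->|uw] := eqVneq u w.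
    by lra.
  have {}uw : 0 < w - u by rewrite subr_gt0 lt_neqAle uw (le_trans uv vw).
  rewrite -ler_pdivrMl// mulrC; apply: leA => c t Kct.
  rewrite ler_pdivrMr//.
  have h1 : (w - v) * A u <= (w - v) * (c - t * u).
    by rewrite ler_wpM2l ?subr_ge0// Ale.
  have h2 : (v - u) * A w <= (v - u) * (c - t * w).
    by rewrite ler_wpM2l ?subr_ge0// Ale.
  lra.
have grad := concave_supergradient Adecr Alip Aconc.
pose x u := sval (cid2 (grad u)).
(* The touching point [(a + t * b, t)] bounds [A b] above by [a]; every point of [K] lies above the
   line of [a] and [b], which bounds it below. *)
have APE t a b : P t a b -> A b = a.
  move=> Ptab; apply/eqP; rewrite eq_le; apply/andP; split.
    by have := Ale b _ _ (KP _ _ _ Ptab); rewrite addrK.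
  by apply: leA => c t' [_ /= /(_ _ _ _ Ptab)]; lra.
exists A, x; split => //.
- by move=> u; rewrite /x; case: cid2.
- by move=> u; rewrite /x; case: cid2.
- by move=> t a b Ptab v; have := Ale v _ _ (KP _ _ _ Ptab); lra.
Qed.

(** Cut [a, b] into [n] equal pieces. The increments of [x] telescope, so the total variation of [D]
    along the grid is at most [(x b - x a) * (b - a) / n], which is arbitrarily small. *)
Lemma eq_of_monotone_modulus (R : realType) (D x : R -> R) (a b : R) : a <= b ->
  (forall u v, a <= u -> u <= v -> `|D v - D u| <= (x v - x u) * (v - u)) ->
  D a = D b.
Proof.
move=> ab Dx; apply/eqP; rewrite eq_sym -subr_eq0 -normr_le0; apply/ler_addgt0Pl => e e0.
rewrite addr0.
pose M := (x b - x a) * (b - a).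
have M0 : 0 <= M by apply: le_trans (Dx _ _ (lexx a) ab).
(* The bound makes [M / n] at most [e]; the successor keeps [n] nonzero. *)
pose n := (Num.bound (M / e)).+1.
pose d := (b - a) / n%:R.
have d0 : 0 <= d by rewrite divr_ge0 ?subr_ge0.
have step k : `|D (a + k%:R * d) - D a| <= d * (x (a + k%:R * d) - x a).
  elim: k => [|k IH]; first by rewrite mul0r addr0 !subrr normr0 mulr0.
  have kd : 0 <= k%:R * d by rewrite mulr_ge0.
  have := Dx (a + k%:R * d) (a + k.+1%:R * d).
  rewrite lerDl kd lerD2l ler_wpM2r ?ler_nat// => /(_ isT isT) h.
  have -> : D (a + k.+1%:R * d) - D a =
    (D (a + k.+1%:R * d) - D (a + k%:R * d)) + (D (a + k%:R * d) - D a) by lra.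
  apply: le_trans (ler_normD _ _) _; apply: le_trans (lerD h IH) _.
  by rewrite -natr1; lra.
have := step n; rewrite /d mulrCA mulfV ?pnatr_eq0// mulr1.
have -> : a + (b - a) = b by lra.
move=> /le_trans; apply; rewrite mulrAC [X in X / _]mulrC -/M ler_pdivrMr ?ltr0n//.
rewrite mulrC -ler_pdivrMr//; apply: ltW.
apply: lt_le_trans (archi_boundP _) _; first by rewrite divr_ge0// ltW.
by rewrite ler_nat.
Qed.

Lemma nondecreasing_measurable (R : realType) (f : R -> R) :
  {homo f : u v / u <= v} ->
  measurable_fun [set: measurableTypeR R] (f : _ -> measurableTypeR R).
Proof.
move=> ndf; apply: (measurability _ (RGenCInfty.measurableE R)).
move=> _ [_ [a ->] <-]; rewrite setTI.
apply: is_interval_measurable => u v /=; rewrite !in_itv/= !andbT => au _ w /andP[uw _].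
by rewrite in_itv/= andbT (le_trans au)// ndf.
Qed.

Lemma bounded_integrable d (T : measurableType d) (R : realType)
    (mu : {measure set T -> \bar R}) (D : set T) (f : T -> R) (M : R) :
  measurable D -> (mu D < +oo)%E -> measurable_fun D f ->
  (forall x, D x -> `|f x| <= M) -> mu.-integrable D (EFin \o f).
Proof.
move=> mD muD mf fM; apply/integrableP; split; first exact/measurable_EFinP.
apply: (@le_lt_trans _ _ (M%:E * mu D)%E).
  rewrite -integral_cst//.
  apply: ge0_le_integral => //=.
  exact/measurable_EFinP/measurableT_comp.
(* A point of [D] is what shows that [M] is nonnegative; on the empty set [M] may have any sign. *)
have [->|/set0P[x Dx]] := eqVneq D set0.
  by rewrite measure0 mule0 ltry.
rewrite lte_mul_pinfty// lee_fin; exact: le_trans (fM _ Dx).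
Qed.

Section supergradient_integral.
Context (R : realType).
Local Notation mu := (@lebesgue_measure R).
Variables A x : R -> R.
Hypothesis x01 : forall u, 0 <= x u <= 1.
Hypothesis Ax : forall u v, A v <= A u - x u * (v - u).

Lemma supergradient_nondecreasing : {homo x : u v / u <= v}.
Proof.
move=> u v; rewrite le_eqVlt => /predU1P[->//|uv].
have h1 := Ax u v; have h2 := Ax v u.
have : 0 <= (x v - x u) * (v - u) by lra.
by rewrite pmulr_lge0 ?subr_gt0// subr_ge0.
Qed.

Lemma supergradient_integrable (a b : R) : mu.-integrable `[a, b[ (EFin \o x).
Proof.
apply: (@bounded_integrable _ _ _ _ _ _ 1) => //.
- by rewrite /= lebesgue_measure_itv/=; case: ifP => _; rewrite ?ltry.
- apply: measurable_funTS; exact: nondecreasing_measurable supergradient_nondecreasing.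
- by move=> u _; have /andP[? ?] := x01 u; rewrite ger0_norm.
Qed.

(** On [u, v] both the integral of [x] and [A u - A v] lie between [x u * (v - u)] and
    [x v * (v - u)]. So the integral plus [A] has the modulus required by [eq_of_monotone_modulus]
    and is constant; no differentiation of [A] enters. *)
Lemma supergradient_Rintegral (a b : R) : a <= b ->
  \int[mu]_(u in `[a, b[) x u = A a - A b.
Proof.
move=> ab; pose J b := \int[mu]_(u in `[a, b[) x u.
suff : J a + A a = J b + A b.
  by rewrite {1}/J set_itvco0 Rintegral_set0 -/(J b); lra.
apply: (@eq_of_monotone_modulus _ (fun b => J b + A b) x) => // u v au uv.
have leJ (c : R) : fine (mu `[u, v[) * c = (v - u) * c.
  rewrite lebesgue_measure_itv/= lte_fin; case: ltP => [//|vu].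
  by have -> : v = u by [apply/eqP; rewrite eq_le vu uv]; rewrite subrr.
have cint (c : R) : mu.-integrable `[u, v[ (EFin \o cst c).
  apply: (@bounded_integrable _ _ _ _ _ _ `|c|) => //.
  by rewrite /= lebesgue_measure_itv/=; case: ifP => _; rewrite ?ltry.
have Juv : J v = J u + \int[mu]_(w in `[u, v[) x w.
  rewrite /J -Rintegral_setU//.
  - by rewrite -itv_bndbnd_setU// bnd_simp.
  - rewrite -itv_bndbnd_setU ?bnd_simp//.
    exact: supergradient_integrable.
  - apply/disj_setPS => w [/=]; rewrite !in_itv/= => /andP[_ wu] /andP[uw _].
    by move: (lt_le_trans wu uw); rewrite ltxx.
have lo : x u * (v - u) <= \int[mu]_(w in `[u, v[) x w.
  rewrite mulrC -leJ mulrC -Rintegral_cst//.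
  apply: le_Rintegral => //; first exact: cint.
    exact: supergradient_integrable.
  by move=> w /=; rewrite in_itv/= => /andP[uw _]; exact: supergradient_nondecreasing.
have hi : \int[mu]_(w in `[u, v[) x w <= x v * (v - u).
  rewrite [leRHS]mulrC -leJ [leRHS]mulrC -Rintegral_cst//.
  apply: le_Rintegral => //; [exact: supergradient_integrable|exact: cint|].
  move=> w /=; rewrite in_itv/= => /andP[_ /ltW wv].
  exact: supergradient_nondecreasing.
have h1 := Ax u v; have h2 := Ax v u.
clear leJ cint.
rewrite Juv; move: (J u) (\int[mu]_(w in `[u, v[) x w) lo hi => Ju I lo hi.
by rewrite ler_norml; apply/andP; split; lra.
Qed.

End supergradient_integral.

(** * Measures with a density *)

Lemma probability_of_density d (T : measurableType d) (R : realType)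
    (mu : {measure set T -> \bar R}) (f : T -> R) :
  measurable_fun setT f -> (forall x, 0 <= f x) ->
  (\int[mu]_x (f x)%:E = 1)%E ->
  exists nu : probability T R,
    forall A, measurable A -> (nu A = \int[mu]_(x in A) (f x)%:E)%E.
Proof.
move=> mf f0 f1; pose m (A : set T) := (\int[mu]_(x in A) (f x)%:E)%E.
have m0 : m set0 = 0%E by rewrite /m integral_set0.
have m_ge0 A : (0 <= m A)%E by apply: integral_ge0 => x _; rewrite lee_fin.
have msig : semi_sigma_additive m.
  move=> F mF tF mUF; rewrite [X in _ --> X](_ : _ =
      lim (\sum_(0 <= i < n) m (F i) @[n --> \oo])%E).
    by apply: is_cvg_nneseries => k _ _; exact: m_ge0.
  rewrite /m ge0_integral_bigcup//.
- exact/measurable_EFinP/measurable_funTS.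
- by move=> x _; rewrite lee_fin.
pose M : {measure set T -> \bar R} :=
  HB.pack m (isMeasure.Build _ _ _ m m0 m_ge0 msig).
pose P : probability T R :=
  HB.pack m (isMeasure.Build _ _ _ m m0 m_ge0 msig)
    (Measure_isProbability.Build _ _ _ M f1).
by exists P.
Qed.

Section integral_density.
Context d (T : measurableType d) (R : realType).
Variables mu nu : {measure set T -> \bar R}.
Variable f : T -> R.
Hypotheses (mf : measurable_fun setT f) (f0 : forall x, 0 <= f x).
Hypothesis nuE :
  forall A, measurable A -> (nu A = \int[mu]_(x in A) (f x)%:E)%E.

Import HBNNSimple.

Let integral_density_nnsfun (g : {nnsfun T >-> R}) :
  (\int[nu]_x (g x)%:E = \int[mu]_x ((g x)%:E * (f x)%:E))%E.
Proof.
under [LHS]eq_integral do rewrite fimfunE -fsumEFin//.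
rewrite [LHS]ge0_integral_fsum//; last 2 first.
  - by move=> r; exact/measurable_EFinP/measurableT_comp.
  - by move=> n x _; rewrite EFinM nnfun_muleindic_ge0.
under [RHS]eq_integral.
  move=> x xD; rewrite fimfunE -fsumEFin// muleC ge0_mule_fsumr; last first.
    by move=> r; rewrite EFinM nnfun_muleindic_ge0.
  over.
rewrite [RHS]ge0_integral_fsum//; last 2 first.
  - move=> r; apply: emeasurable_funM; first exact/measurable_EFinP.
    by apply/measurable_EFinP; apply/measurableT_comp.
  - by move=> n x _; apply: mule_ge0; rewrite ?lee_fin// -lee_fin EFinM nnfun_muleindic_ge0.
apply: eq_fsbigr => r _.
rewrite integralZl_indic_nnsfun// integral_indic// setIT nuE//.
have [r0|r0] := ltP r 0.
  rewrite preimage_nnfun0// integral_set0 mule0 integral0_eq// => x _.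
  by rewrite indic0 mulr0 mule0.
rewrite -ge0_integralZl//; last 2 first.
- by apply/measurable_EFinP; exact: measurable_funTS.
- by move=> x _; rewrite lee_fin.
rewrite integral_mkcond; apply: eq_integral => x _.
rewrite patchE indicE; case: ifPn => xr.
  by rewrite mulr1 muleC.
by rewrite mulr0 mule0.
Qed.

(** Monotone convergence from simple functions. The measures are arbitrary because the lemma serves
    twice: for the constructed signal, with [mu] the Lebesgue measure, and for Bayes' rule, where
    the belief is the density of one likelihood with respect to the mixture. *)
Lemma ge0_integral_density (g : T -> \bar R) :
  measurable_fun setT g -> (forall x, 0 <= g x)%E ->
  (\int[nu]_x g x = \int[mu]_x (g x * (f x)%:E))%E.
Proof.
move=> mg g0.
pose g_ := nnsfun_approx measurableT mg.
have g_cvg x : ((g_ n x)%:E @[n --> \oo] --> g x)%E by exact: cvg_nnsfun_approx.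
transitivity (lim (\int[nu]_x (g_ n x)%:E @[n --> \oo])%E).
  rewrite -monotone_convergence//=.
  - by apply: eq_integral => x _; apply/esym/cvg_lim.
  - by move=> n; exact/measurable_EFinP/measurable_funTS.
  - by move=> n ? _; rewrite lee_fin.
  - by move=> ? _ ? ? mn; rewrite lee_fin; exact/lefP/nd_nnsfun_approx.
rewrite (_ : (fun n => _) = fun n => (\int[mu]_x ((g_ n x)%:E * (f x)%:E))%E); last first.
  by apply/funext => n; exact: integral_density_nnsfun.
rewrite -monotone_convergence//=.
- apply: eq_integral => x _; apply/cvg_lim => //.
  under eq_fun do rewrite muleC.
  by rewrite muleC; exact: cvgeZl.
- move=> n; apply: emeasurable_funM => //; exact/measurable_EFinP.
- by move=> n x _; rewrite mule_ge0// lee_fin.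
- move=> x _ m n mn; apply: lee_wpmul2r; rewrite lee_fin//.
  exact/lefP/nd_nnsfun_approx.
Qed.

End integral_density.

(** * Optimal prices *)

(** The nonnegative function [M - f] has integral at most zero, hence vanishes almost everywhere.
    This turns optimality of a random price into optimality of almost every price drawn. *)
Lemma integral_le_upper_bound_eq d (T : measurableType d) (R : realType)
    (P : probability T R) (f : T -> R) (M : R) :
  measurable_fun setT f -> (forall x, f x <= M) ->
  (M%:E <= \int[P]_x (f x)%:E)%E ->
  P [set x | f x != M] = 0%E.
Proof.
move=> mf fM MP.
have mEf : measurable_fun setT (EFin \o f) by exact/measurable_EFinP.
(* [f] is bounded only above: the positive part is at most [|M|], and the assumed lower bound on the
   integral excludes minus infinity. *)
have ffin : (\int[P]_x (f x)%:E)%E \is a fin_num.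
  rewrite fin_real// (lt_le_trans _ MP) ?ltNyr//=.
  rewrite integralE (le_lt_trans (y := `|M|%:E))//; last exact: ltry.
  rewrite -[leRHS]sube0; apply: leeB; last exact: integral_ge0.
  rewrite -[leRHS]mule1 -(probability_setT P) -integral_cst//.
  apply: ge0_le_integral => //; first exact: measurable_funepos.
  move=> x _; rewrite /= funeposE /maxe; case: ifP => _; rewrite lee_fin//.
  exact: le_trans (fM x) (ler_norm _).
have fint : P.-integrable setT (EFin \o f).
  by apply/integrableP; split => //; rewrite integral_fin_num_abs.
have Mint : P.-integrable setT (EFin \o cst M).
  by apply: (@bounded_integrable _ _ _ _ _ _ `|M|) => //; rewrite /= probability_setT ltry.
have mg : measurable_fun setT (fun x => (M - f x)%:E).
  by apply/measurable_EFinP; apply: measurable_funB.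
have : (\int[P]_x `|(M - f x)%:E| = 0)%E.
  under eq_integral => x _ do rewrite gee0_abs ?lee_fin ?subr_ge0// EFinB.
  rewrite integralB_EFin//= integral_cst//= probability_setT mule1.
  apply/eqP; rewrite eq_le; apply/andP; split.
    by rewrite sube_le0.
  rewrite -(_ : \int[P]_x (M - f x)%:E = M%:E - \int[P]_x (f x)%:E)%E.
    by apply: integral_ge0 => x _; rewrite lee_fin subr_ge0.
  under eq_integral do rewrite EFinB.
  by rewrite integralB_EFin//= integral_cst//= probability_setT mule1.
move/(ae_eq_integral_abs _ measurableT mg) => [N [mN N0 sN]].
apply/eqP; rewrite eq_le measure_ge0 andbT -N0.
apply: le_measure; rewrite ?inE//.
  rewrite (_ : [set x | _] = f @^-1` (~` [set M])); last by apply/seteqP; split => x /= /eqP.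
  by rewrite -[X in measurable X]setTI; apply: mf => //; apply: measurableC.
move=> x /= fxM; apply: sN => /= /(_ I) /eqP; rewrite eqe subr_eq0 eq_sym.
by apply/negP.
Qed.

Lemma integral_two_points (R : realType) (P : probability (measurableTypeR R) R)
    (x y : R) (f : R -> R) : x != y ->
  P (~` [set x; y]) = 0%E -> measurable_fun [set: measurableTypeR R] f ->
  (\int[P]_p (f p)%:E =
   (f x * (1 - fine (P [set y])) + f y * fine (P [set y]))%:E)%E.
Proof.
move=> xy Pxy mf.
have Pfin A : measurable A -> (fine (P A))%:E = P A.
  by move=> mA; rewrite fineK// fin_num_measure.
have m2 : measurable ([set x; y] : set (measurableTypeR R)).
  by apply: measurableU; exact: measurable_set1.
have PxE : P [set x] = (1 - fine (P [set y]))%:E.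
  rewrite EFinB Pfin//.
  have : P setT = (P [set x] + P [set y])%E.
    rewrite -(setvU [set x; y]) measureU//; [|exact: measurableC|by rewrite setICl].
    rewrite [X in (X + _ = _)%E]Pxy add0e measureU//.
    by apply/seteqP; split => // z [-> /eqP]; rewrite (negbTE xy).
  rewrite probability_setT => ->; rewrite addeK//; exact: fin_num_measure.
(* [g] agrees with [f] on the two atoms, hence almost everywhere. *)
pose g p := f x * \1_[set x] p + f y * \1_[set y] p.
have int1 c z : P.-integrable setT (EFin \o (fun p => c * \1_[set z] p)).
  apply: (@bounded_integrable _ _ _ _ _ _ `|c|) => //.
  - by rewrite /= probability_setT ltry.
  - by apply: measurable_funM => //; exact/measurable_indic/measurable_set1.
  - by move=> p _; rewrite normrM ler_piMr// ger0_norm// indicE; case: (_ \in _).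
transitivity (\int[P]_p (g p)%:E)%E.
  apply: ae_eq_integral => //.
  - exact/measurable_EFinP.
  - apply/measurable_EFinP; apply: measurable_funD; apply: measurable_funM => //;
    exact/measurable_indic/measurable_set1.
  - exists (~` [set x; y]); split => //; first exact: measurableC.
    move=> p /=; apply: contra_not => -[] -> _; rewrite /g !indicE.
    + by rewrite mem_set// memNset ?mulr1 ?mulr0 ?addr0//; apply/eqP.
    + rewrite memNset ?mem_set ?mulr1 ?mulr0 ?add0r//.
      by apply/eqP; rewrite eq_sym.
rewrite /g; under eq_integral do rewrite EFinD.
rewrite integralD_EFin//; try exact: int1.
have ind c z : (\int[P]_p (c * \1_[set z] p)%:E = c%:E * P [set z])%E.
  under eq_integral do rewrite EFinM.
  rewrite integralZl//; first by rewrite integral_indic// setIT.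
  by have := int1 1 z; congr (_.-integrable _ _); apply/funext => p/=; rewrite mul1r.
by rewrite !ind PxE -[in X in (_ + X)%E]Pfin// -!EFinM -EFinD.
Qed.

(** * Integrals of bounded functions under a probability measure *)

Lemma probability_bounded_integrable d (T : measurableType d) (R : realType)
    (P : probability T R) (f : T -> R) (M : R) :
  measurable_fun setT f -> (forall x, `|f x| <= M) ->
  P.-integrable setT (EFin \o f).
Proof.
move=> mf fM; apply: (@bounded_integrable _ _ _ _ _ _ M) => //.
by rewrite /= probability_setT ltry.
Qed.

Lemma probability_Rintegral_cst d (T : measurableType d) (R : realType)
    (P : probability T R) (c : R) : \int[P]_x c = c.
Proof. by rewrite Rintegral_cst// /= probability_setT mulr1. Qed.

Lemma EFin_Rintegral d (T : measurableType d) (R : realType)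
    (mu : {measure set T -> \bar R}) (D : set T) (f : T -> R) :
  measurable D -> mu.-integrable D (EFin \o f) ->
  (\int[mu]_(x in D) f x)%:E = (\int[mu]_(x in D) (f x)%:E)%E.
Proof. by move=> mD fi; rewrite /Rintegral fineK//; exact: integrable_fin_num. Qed.

Lemma probability_Rintegral01 d (T : measurableType d) (R : realType)
    (P : probability T R) (f : T -> R) :
  measurable_fun setT f -> (forall x, 0 <= f x <= 1) ->
  0 <= \int[P]_x f x <= 1.
Proof.
move=> mf f01; rewrite Rintegral_ge0/=; last by move=> x _; case/andP: (f01 x).
rewrite -[leRHS](probability_Rintegral_cst P); apply: le_Rintegral => //.
- by apply: (@probability_bounded_integrable _ _ _ _ _ 1) => // x;
    rewrite ger0_norm; case/andP: (f01 x).
- by apply: (@probability_bounded_integrable _ _ _ _ _ 1) => // x; rewrite normr1.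
- by move=> x _; case/andP: (f01 x).
Qed.

Lemma probability_Rintegral_affine d (T : measurableType d) (R : realType)
    (P : probability T R) (f : T -> R) (M a b : R) :
  measurable_fun setT f -> (forall x, `|f x| <= M) ->
  \int[P]_x (a + b * f x) = a + b * \int[P]_x f x.
Proof.
move=> mf fM.
have fi := probability_bounded_integrable P mf fM.
rewrite RintegralD//.
- by rewrite probability_Rintegral_cst RintegralZl.
- by apply: (@probability_bounded_integrable _ _ _ _ _ `|a|).
- apply: (@probability_bounded_integrable _ _ _ _ _ (`|b| * M)).
    by apply: measurable_funM.
  by move=> x; rewrite normrM ler_wpM2l.
Qed.

Lemma probability_Rintegral_affine2 d (T : measurableType d) (R : realType)
    (P : probability T R) (f g : T -> R) (a b c : R) :
  measurable_fun setT f -> (forall x, 0 <= f x <= 1) ->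
  measurable_fun setT g -> (forall x, 0 <= g x <= 1) ->
  P.-integrable setT (EFin \o (fun x => a + b * f x - c * g x)) /\
  \int[P]_x (a + b * f x - c * g x) =
  a + b * \int[P]_x f x - c * \int[P]_x g x.
Proof.
move=> mf f01 mg g01.
have f1 x : `|f x| <= 1 by have /andP[? ?] := f01 x; rewrite ger0_norm.
have g1 x : `|g x| <= 1 by have /andP[? ?] := g01 x; rewrite ger0_norm.
have fi : P.-integrable setT (EFin \o (fun x => a + b * f x)).
  apply: (@probability_bounded_integrable _ _ _ _ _ (`|a| + `|b|)).
    by apply: measurable_funD => //; apply: measurable_funM.
  move=> x; rewrite (le_trans (ler_normD _ _))// lerD2l normrM ler_piMr//.
have gi : P.-integrable setT (EFin \o (fun x => c * g x)).
  apply: (@probability_bounded_integrable _ _ _ _ _ `|c|).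
    by apply: measurable_funM.
  by move=> x; rewrite normrM ler_piMr.
split; first exact: (integrableB measurableT fi gi).
rewrite RintegralB// (probability_Rintegral_affine _ _ _ mf f1) RintegralZl//.
exact: probability_bounded_integrable g1.
Qed.

(** An alias to which the structure of a probability measure is attached, so that the lemmas on
    probabilities apply to the prices and signal choices of a fixed type. *)
Definition pker_probability d d' (X : measurableType d) (Y : measurableType d')
    (R : realType) (k : R.-pker X ~> Y) (x : X) : set Y -> \bar R := k x.

HB.instance Definition _ d d' (X : measurableType d) (Y : measurableType d')
    (R : realType) (k : R.-pker X ~> Y) (x : X) :=
  Measure.on (pker_probability k x).

HB.instance Definition _ d d' (X : measurableType d) (Y : measurableType d')
    (R : realType) (k : R.-pker X ~> Y) (x : X) :=
  Measure_isProbability.Build _ _ _ (pker_probability k x) (prob_kernel x).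

(** * Necessary conditions *)

Section equilibrium_outcome.
Context (R : realType) (L H : R).
Hypotheses (L_gt0 : 0 < L) (ltLH : L < H).
Variables (Theta : set (measurableTypeR R)) (M : menu R) (sigma : assessment M).
Hypothesis mTheta : measurable Theta.
Hypothesis Theta01 : Theta `<=` [set t : R | 0 <= t <= 1].
Hypothesis sigma_eq : equilibrium sigma L H Theta.

Let H_gt0 : 0 < H. Proof. exact: lt_trans ltLH. Qed.

Definition high_price_prob (v : value) (t : R) (m : menu_index M) : R :=
  \int[signal_dist (M m) v]_s fine (pricing sigma m (t, s) [set H]).

(** These are the [q_v(t)] of the overview, through which alone the given equilibrium enters the
    construction of the signal. *)
Definition ex_ante_high_price_prob (v : value) (t : R) : R :=
  \int[Defs.choice sigma t]_m high_price_prob v t m.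

Lemma buy_leq v p : buy sigma v p = (p <= buyer_value L H v).
Proof.
case: sigma_eq => _ _ _ _ /(_ v p) [opt indiff].
case: (ltgtP p (buyer_value L H v)) => [pv|vp|/indiff//].
  by have := opt true; case: (buy sigma v p) => //; rewrite mulr1 mulr0; lra.
by have := opt false; case: (buy sigma v p) => //; rewrite mulr1 mulr0; lra.
Qed.

Lemma price_profitE b p : price_profit sigma b p =
  b * (p * (p <= H)%R%:R) + (1 - b) * (p * (p <= L)%R%:R).
Proof. by rewrite /price_profit !buy_leq. Qed.

Lemma measurable_accepted_price (c : R) :
  measurable_fun [set: measurableTypeR R] (fun p : R => (p <= c)%R%:R : R).
Proof.
rewrite (_ : (fun p => _) = \1_`]-oo, c]).
  by apply: measurable_indic; exact: measurable_itv.
apply/funext => p; rewrite indicE; congr (_%:R); congr nat_of_bool.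
by apply/idP/idP; [move=> pc; rewrite inE/= in_itv|rewrite inE/= in_itv].
Qed.

Lemma measurable_accepted_payment (c : R) :
  measurable_fun [set: measurableTypeR R] (fun p : R => p * (p <= c)%R%:R : R).
Proof. by apply: measurable_funM => //; exact: measurable_accepted_price. Qed.

(** Every price other than [L] and [H] earns strictly less than the better of the two: below [L] by
    raising it to [L]; between them by raising it to [H], or, at belief 0, because it earns nothing;
    above [H] because nobody buys. The expected profit attains the maximum, so these prices have
    mass zero, and so does the worse of [L] and [H]. *)
Lemma pricing_support (t : R) (m : menu_index M) (s : realization (M m)) :
  Theta t ->
  let P := pricing sigma m (t, s) in let b := belief sigma m t s in
  [/\ P (~` [set L; H]) = 0%E, (b * H < L -> fine (P [set H]) = 0) &
      (L < b * H -> fine (P [set H]) = 1)].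
Proof.
move=> Tt; have [_ bayes opt _ _] := sigma_eq.
suff : let P := pker_probability (pricing sigma m) (t, s) in
    let b := belief sigma m t s in
  [/\ P (~` [set L; H]) = 0%E, (b * H < L -> fine (P [set H]) = 0) &
      (L < b * H -> fine (P [set H]) = 1)] by [].
move=> P b.
have /andP[b0 b1] : 0 <= b <= 1 by have [_ + _] := bayes t m Tt; exact.
pose rho p := price_profit sigma b p.
have rhoL : rho L = L by rewrite /rho price_profitE lexx (ltW ltLH) !mulr1; lra.
have rhoH : rho H = b * H.
  by rewrite /rho price_profitE lexx leNgt ltLH/= mulr0 mulr0 mulr1 addr0.
have rho_lt p : p != L -> p != H -> rho p < Num.max L (b * H).
  move=> pL pH; rewrite lt_max /rho price_profitE.
  case: (ltgtP p L) pL => // pL _.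
    have -> : p <= H by rewrite (le_trans (ltW pL))// ltW.
    by apply/orP; left; rewrite !mulr1; lra.
  rewrite mulr0 mulr0 addr0; case: (ltgtP p H) pH => // pH _; rewrite ?mulr0 ?L_gt0// mulr1.
  have [->|bn0] := eqVneq b 0; first by rewrite mul0r L_gt0.
  by apply/orP; right; rewrite ltr_pM2l// lt_neqAle eq_sym bn0.
have rho_le p : rho p <= Num.max L (b * H).
  have [->|pL] := eqVneq p L; first by rewrite rhoL le_max lexx.
  have [->|pH] := eqVneq p H; first by rewrite rhoH le_max lexx orbT.
  exact/ltW/rho_lt.
have mrho : measurable_fun [set: measurableTypeR R] rho.
  rewrite (_ : rho = fun p => b * (p * (p <= H)%R%:R) + (1 - b) * (p * (p <= L)%R%:R)).
    by apply: measurable_funD; apply: measurable_funM => //;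
      exact: measurable_accepted_payment.
  by apply/funext => p; exact: price_profitE.
have rhoP : P [set p | rho p != Num.max L (b * H)] = 0%E.
  apply: integral_le_upper_bound_eq mrho rho_le _.
  have hL := opt t m s L Tt; have hH := opt t m s H Tt.
  by rewrite EFin_max ge_max -{1}rhoL -rhoH hL hH.
have mrhoM : measurable ([set p | rho p != Num.max L (b * H)] : set (measurableTypeR R)).
  rewrite (_ : [set x | _] = rho @^-1` (~` [set Num.max L (b * H)])).
    rewrite -[X in measurable X]setTI; apply: mrho => //.
    by apply: measurableC; exact: measurable_set1.
  by apply/seteqP; split => x /= /eqP.
have mset1 (x : R) : measurable ([set x] : set (measurableTypeR R)).
  exact: measurable_set1.
have null (A : set (measurableTypeR R)) : measurable A ->
    A `<=` [set p | rho p != Num.max L (b * H)] -> P A = 0%E.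
  by move=> mA sA; apply: (subset_measure0 mA mrhoM sA rhoP).
have PLH : P (~` [set L; H]) = 0%E.
  apply: null; first by apply: measurableC; apply: measurableU.
  move=> p /= pLH; rewrite lt_eqF// rho_lt//; apply/eqP => pE; apply: pLH;
    [left|right]; exact: pE.
split=> //.
  move=> bHL; rewrite null//= => _ /= ->; rewrite rhoH lt_eqF//.
  by rewrite lt_max bHL.
move=> LbH.
have PL : P [set L] = 0%E.
  by apply: null => // _ /= ->; rewrite rhoL lt_eqF// lt_max LbH orbT.
have PnH : P (~` [set H]) = 0%E.
  apply/eqP; rewrite eq_le measure_ge0 andbT.
  rewrite (le_trans (y := P ([set L] `|` ~` [set L; H])))//.
    apply: le_measure; rewrite ?inE; first exact: measurableC.
      by apply: measurableU => //; apply: measurableC; apply: measurableU.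
    move=> p /= pH; have [pL|pL] := pselect (p = L); [by left|right].
    by case.
  apply: le_trans (measureU2 _ _ _) _ => //.
    by apply: measurableC; apply: measurableU.
  by rewrite [X in (X + _)%E]PL add0e [leLHS]PLH.
have := probability_setC P (measurableC (mset1 H)).
by rewrite setCK [X in (_ - X)%E]PnH sube0 => /(congr1 fine).
Qed.

Lemma measurable_high_price t m :
  measurable_fun setT (fun s => fine (pricing sigma m (t, s) [set H])).
Proof.
apply: (@measurableT_comp _ _ _ _ _ _ fine) => //.
apply: (measurableT_comp (measurable_kernel (pricing sigma m) [set H] _)) => //.
Qed.

Lemma high_price01 t m s : 0 <= fine (pricing sigma m (t, s) [set H]) <= 1.
Proof.
have mH : measurable ([set H] : set (measurableTypeR R)) by exact: measurable_set1.
have PH1 := probability_le1 (pker_probability (pricing sigma m) (t, s)) mH.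
rewrite fine_ge0//= -lee_fin fineK//.
exact: (fin_num_measure (pker_probability (pricing sigma m) (t, s))).
Qed.

Lemma high_price_prob01 v t m : 0 <= high_price_prob v t m <= 1.
Proof.
by apply: probability_Rintegral01;
  [exact: measurable_high_price|exact: high_price01].
Qed.

(** By [pricing_support] the price has at most two atoms, so any expectation is affine in the
    probability of [H]; trade, payments and profits are all read off from this. *)
Lemma expect_priceE (f : R -> R) t m v : Theta t ->
  measurable_fun [set: measurableTypeR R] f ->
  expect_price sigma t m v (EFin \o f) =
  (f L + (f H - f L) * high_price_prob v t m)%:E.
Proof.
move=> Tt mf; rewrite /expect_price.
transitivity (\int[signal_dist (M m) v]_s
    (f L + (f H - f L) * fine (pricing sigma m (t, s) [set H]))%:E)%E.
  apply: eq_integral => s _.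
  have [PLH _ _] := pricing_support s Tt.
  rewrite [LHS](@integral_two_points _
    (pker_probability (pricing sigma m) (t, s)) L H)//.
    by congr EFin; rewrite /pker_probability; ring.
  by rewrite lt_eqF.
rewrite -EFin_Rintegral//.
  congr EFin; apply: (@probability_Rintegral_affine _ _ _ _ _ 1).
    exact: measurable_high_price.
  by move=> s; have /andP[? ?] := high_price01 t s; rewrite ger0_norm.
apply: (@probability_bounded_integrable _ _ _ _ _ (`|f L| + `|f H - f L|)).
  apply: measurable_funD => //; apply: measurable_funM => //.
  exact: measurable_high_price.
move=> s; have /andP[? ?] := high_price01 t s.
rewrite (le_trans (ler_normD _ _))// lerD2l normrM ler_piMr// ger0_norm//.
Qed.

Lemma trade_probE t m v : Theta t ->
  trade_prob sigma t m v =
  (match v with low => 1 - high_price_prob low t m | high => 1 end)%:E.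
Proof.
move=> Tt; rewrite /trade_prob.
rewrite (_ : (fun p => _) = EFin \o (fun p : R => (p <= buyer_value L H v)%R%:R)).
  rewrite expect_priceE//; last exact: measurable_accepted_price.
  case: v => /=; rewrite ?lexx ?(ltW ltLH) ?(leNgt H L) ?ltLH/=; congr EFin; ring.
by apply/funext => p; rewrite /= buy_leq.
Qed.

Lemma paymentE t m v : Theta t ->
  payment sigma t m v =
  (match v with
   | low => L * (1 - high_price_prob low t m)
   | high => L + (H - L) * high_price_prob high t m end)%:E.
Proof.
move=> Tt; rewrite /payment.
rewrite (_ : (fun p => _) = EFin \o (fun p : R => p * (p <= buyer_value L H v)%R%:R)).
  rewrite expect_priceE//; last exact: measurable_accepted_payment.
  case: v => /=; rewrite ?lexx ?(ltW ltLH) ?(leNgt H L) ?ltLH/=; congr EFin; ring.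
by apply/funext => p; rewrite /= buy_leq.
Qed.

Lemma signal_profitE t m : Theta t ->
  signal_profit sigma t m =
  (L + t * (H - L) * high_price_prob high t m
     - (1 - t) * L * high_price_prob low t m)%:E.
Proof.
move=> Tt; rewrite /signal_profit !paymentE// -!EFinM -EFinD /=.
by congr EFin; ring.
Qed.

Lemma price_dist_high v t m :
  price_dist sigma v [set H] (t, m) = (high_price_prob v t m)%:E.
Proof.
rewrite /price_dist /high_price_prob EFin_Rintegral//=; last first.
  apply: (@probability_bounded_integrable _ _ _ _ _ 1).
    exact: measurable_high_price.
  by move=> s; have /andP[? ?] := high_price01 t s; rewrite ger0_norm.
apply: eq_integral => s _; rewrite fineK//.
apply: (fin_num_measure (pker_probability (pricing sigma m) (t, s))).
exact: measurable_set1.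
Qed.

(** Bayes' rule on sets says that the belief is the density of [t] times the high likelihood with
    respect to the mixture of both likelihoods; [ge0_integral_density] extends it from sets to test
    functions [k]. *)
Lemma bayes_Rintegral t m (k : realization (M m) -> R) : Theta t ->
  measurable_fun setT k -> (forall s, 0 <= k s <= 1) ->
  t * \int[signal_dist (M m) high]_s k s =
  t * \int[signal_dist (M m) high]_s (k s * belief sigma m t s) +
  (1 - t) * \int[signal_dist (M m) low]_s (k s * belief sigma m t s).
Proof.
move=> Tt mk k01; have [_ /(_ t m Tt)[mb b01 bayes] _ _ _] := sigma_eq.
have /andP[t0 t1] := Theta01 Tt.
have t1' : 0 <= 1 - t by rewrite subr_ge0.
pose nu := mscale (NngNum t0) (signal_dist (M m) high).
pose mu := measure_add nu (mscale (NngNum t1') (signal_dist (M m) low)).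
have muE (g : realization (M m) -> R) (A : set (realization (M m))) : measurable A ->
    measurable_fun setT g -> (forall s, 0 <= g s) ->
    (\int[mu]_(s in A) (g s)%:E = t%:E * \int[signal_dist (M m) high]_(s in A) (g s)%:E
     + (1 - t)%:E * \int[signal_dist (M m) low]_(s in A) (g s)%:E)%E.
  move=> mA mg g0.
  have mEg : measurable_fun A (EFin \o g) by apply/measurable_EFinP; exact: measurable_funTS.
  by rewrite ge0_integral_measure_add// ?ge0_integral_mscale// => s _; rewrite lee_fin.
have b0 s : 0 <= belief sigma m t s by case/andP: (b01 s).
have k0 s : 0 <= k s by case/andP: (k01 s).
have mbR : measurable_fun setT (belief sigma m t : _ -> R) := mb.
have mkb : measurable_fun setT (fun s => k s * belief sigma m t s).
  exact: measurable_funM.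
have nuE A : measurable A -> nu A = (\int[mu]_(s in A) (belief sigma m t s)%:E)%E.
  by move=> mA; rewrite muE// bayes.
have := @ge0_integral_density _ _ _ mu nu (belief sigma m t) mbR b0 nuE (EFin \o k).
rewrite ge0_integral_mscale//; last 2 first.
- exact/measurable_EFinP.
- by move=> s _; rewrite lee_fin.
under [in X in _ -> _ -> _ = X]eq_integral do rewrite /= -EFinM.
rewrite muE//; last by move=> s; rewrite mulr_ge0.
have kbi v : (signal_dist (M m) v).-integrable setT
    (EFin \o (fun s => k s * belief sigma m t s)).
  apply: (@probability_bounded_integrable _ _ _ _ _ 1) => // s.
  have /andP[_ ?] := b01 s; have /andP[_ ?] := k01 s.
  by rewrite ger0_norm ?mulr_ge0// mulr_ile1.
have ki : (signal_dist (M m) high).-integrable setT (EFin \o k).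
  apply: (@probability_bounded_integrable _ _ _ _ _ 1) => // s.
  by have /andP[_ ?] := k01 s; rewrite ger0_norm.
rewrite -(EFin_Rintegral measurableT (kbi high)).
rewrite -(EFin_Rintegral measurableT (kbi low)).
rewrite -(EFin_Rintegral measurableT ki).
rewrite -!EFinM -EFinD => h; apply: EFin_inj; apply: h; first exact/measurable_EFinP.
by move=> s; rewrite lee_fin.
Qed.

(** Here [k] is any rule for charging [H] after each realization. It will be the pricing of another
    type, for imitation, or a constant, for ignoring the signal. *)
Lemma best_reply_profit t m (k : realization (M m) -> R) : Theta t ->
  measurable_fun setT k -> (forall s, 0 <= k s <= 1) ->
  L + t * (H - L) * (\int[signal_dist (M m) high]_s k s)
    - (1 - t) * L * (\int[signal_dist (M m) low]_s k s) <=
  L + t * (H - L) * high_price_prob high t m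
    - (1 - t) * L * high_price_prob low t m.
Proof.
move=> Tt mk k01; have [_ /(_ t m Tt)[mb b01 _] _ _ _] := sigma_eq.
have /andP[t0 t1] := Theta01 Tt.
have mbR : measurable_fun setT (belief sigma m t : _ -> R) := mb.
pose w s := fine (pricing sigma m (t, s) [set H]).
have mw : measurable_fun setT w by exact: measurable_high_price.
have w01 s : 0 <= w s <= 1 by exact: high_price01.
have int01 v (g : realization (M m) -> R) :
    measurable_fun setT g -> (forall s, 0 <= g s <= 1) ->
    (signal_dist (M m) v).-integrable setT (EFin \o g).
  move=> mg g01; apply: (@probability_bounded_integrable _ _ _ _ _ 1) => // s.
  by have /andP[? ?] := g01 s; rewrite ger0_norm.
have gb01 (g : realization (M m) -> R) : (forall s, 0 <= g s <= 1) ->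
    forall s, 0 <= g s * belief sigma m t s <= 1.
  move=> g01 s; have /andP[? ?] := g01 s; have /andP[? ?] := b01 s.
  by rewrite mulr_ge0// mulr_ile1.
have mgb (g : realization (M m) -> R) : measurable_fun setT g ->
    measurable_fun setT (fun s => g s * belief sigma m t s).
  by move=> mg; exact: measurable_funM.
have intHg v (g : realization (M m) -> R) (c : R) :
    measurable_fun setT g -> (forall s, 0 <= g s <= 1) ->
    (signal_dist (M m) v).-integrable setT (EFin \o (fun s => c * g s)).
  move=> mg g01; apply: (@probability_bounded_integrable _ _ _ _ _ `|c|).
    by apply: measurable_funM.
  by move=> s; have /andP[? ?] := g01 s; rewrite normrM (ger0_norm (x := g s))// ler_piMr.
(* By Bayes' rule the expected gain from posting [H] with probability [g] is
   the expectation of [(belief * H - L) * g], maximized pointwise by [w]. *)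
pose e v (g : realization (M m) -> R) :=
  \int[signal_dist (M m) v]_s (H * (g s * belief sigma m t s) - L * g s).
have eE v (g : realization (M m) -> R) :
    measurable_fun setT g -> (forall s, 0 <= g s <= 1) ->
    e v g = H * \int[signal_dist (M m) v]_s (g s * belief sigma m t s)
          - L * \int[signal_dist (M m) v]_s g s.
  move=> mg g01; rewrite /e RintegralB//; last 2 first.
  - by apply: intHg; [exact: mgb|exact: gb01].
  - exact: intHg.
  by rewrite !RintegralZl//; [exact: int01|apply: int01; [exact: mgb|exact: gb01]].
have key (g : realization (M m) -> R) :
    measurable_fun setT g -> (forall s, 0 <= g s <= 1) ->
    t * (H - L) * (\int[signal_dist (M m) high]_s g s)
      - (1 - t) * L * (\int[signal_dist (M m) low]_s g s) =
    t * e high g + (1 - t) * e low g.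
  move=> mg g01; have := bayes_Rintegral Tt mg g01.
  rewrite !eE//.
  set A := Rintegral _ _ _; set B := Rintegral _ _ _; set C := Rintegral _ _ _.
  set D := Rintegral _ _ _.
  move=> h.
  have -> : t * (H - L) * A - (1 - t) * L * D =
    H * (t * A) - L * t * A - (1 - t) * L * D by ring.
  by rewrite h; ring.
have inte v (g : realization (M m) -> R) :
    measurable_fun setT g -> (forall s, 0 <= g s <= 1) ->
    (signal_dist (M m) v).-integrable setT
      (EFin \o (fun s => H * (g s * belief sigma m t s) - L * g s)).
  move=> mg g01; have i1 := intHg v _ H (mgb _ mg) (gb01 _ g01).
  exact: (integrableB measurableT i1 (intHg v _ L mg g01)).
(* The comparison is pointwise in [s], so it holds under each value separately; where the belief
   makes [L] and [H] equally good both integrands vanish. *)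
have ele v : e v k <= e v w.
  apply: le_Rintegral => //.
  - exact: inte.
  - exact: inte.
  move=> s _; have [_ wlo whi] := pricing_support s Tt.
  have /andP[k0 k1] := k01 s.
  have E (x : R) : H * (x * belief sigma m t s) - L * x =
    (belief sigma m t s * H - L) * x by ring.
  rewrite !E; case: (ltgtP (belief sigma m t s * H) L) => [bL|Lb|->].
  - rewrite /w wlo// mulr0; apply: mulr_le0_ge0 => //; lra.
  - by rewrite /w whi// ler_wpM2l//; lra.
  - by rewrite subrr !mul0r.
have h1 := key k mk k01; have h2 := key w mw w01.
have h3 : t * e high k <= t * e high w by rewrite ler_wpM2l.
have h4 : (1 - t) * e low k <= (1 - t) * e low w by rewrite ler_wpM2l ?subr_ge0.
rewrite /high_price_prob -/w -!addrA lerD2l h1.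
by rewrite [leRHS]h2 lerD.
Qed.

Lemma measurable_high_price_prob v t : Theta t ->
  measurable_fun setT (high_price_prob v t).
Proof.
move=> Tt; have [mo _ _ _ _] := sigma_eq.
rewrite (_ : high_price_prob v t = fine \o (price_dist sigma v [set H] \o pair t)).
  apply: measurableT_comp => //.
  apply: (measurable_comp _ _ (mo v [set H] (measurable_set1 H))).
  - by apply: measurableX.
  - by move=> _ [m _ <-].
  - exact: pair1_measurable.
by apply/funext => m /=; rewrite price_dist_high.
Qed.

Lemma measurable_ex_ante_high_price_prob v :
  measurable_fun Theta (ex_ante_high_price_prob v).
Proof.
have [mo _ _ _ _] := sigma_eq.
(* Measurability is assumed only over [Theta]; extension by zero gives the globally measurable
   function that integration against a kernel requires. *)
pose k := price_dist sigma v [set H] \_ (Theta `*` setT).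
have mk : measurable_fun setT k.
  apply/(measurable_restrictT _ _).1; first exact: measurableX.
  exact: (mo v [set H] (measurable_set1 H)).
have k0 tm : (0 <= k tm)%E.
  rewrite /k patchE; case: ifP => // _; case: tm => t m.
  by rewrite price_dist_high lee_fin; case/andP: (high_price_prob01 v t m).
have mK := measurable_fun_integral_finite_kernel k (Defs.choice sigma) k0 mk.
apply: (@eq_measurable_fun _ _ _ _ _
  (fine \o (fun t => \int[Defs.choice sigma t]_m k (t, m))%E)).
  move=> t /[!inE] Tt; rewrite /= /ex_ante_high_price_prob /Rintegral.
  congr fine; apply: eq_integral => m _.
  by rewrite /k patchE mem_set//= price_dist_high.
by apply: measurable_funTS; apply: measurableT_comp.
Qed.

Lemma ex_ante_high_price_prob01 v t : Theta t ->
  0 <= ex_ante_high_price_prob v t <= 1.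
Proof.
move=> Tt; apply: (@probability_Rintegral01 _ _ _ (pker_probability (Defs.choice sigma) t)).
  exact: measurable_high_price_prob.
exact: high_price_prob01.
Qed.

Lemma choice_affine t (a b c : R) : Theta t ->
  (\int[Defs.choice sigma t]_m
     (a + b * high_price_prob high t m - c * high_price_prob low t m)%:E =
   (a + b * ex_ante_high_price_prob high t
      - c * ex_ante_high_price_prob low t)%:E)%E.
Proof.
move=> Tt.
have [hi hE] := @probability_Rintegral_affine2 _ _ _
  (pker_probability (Defs.choice sigma) t) _ _ a b c
  (measurable_high_price_prob high Tt) (high_price_prob01 high t)
  (measurable_high_price_prob low Tt) (high_price_prob01 low t).
rewrite [RHS](_ : _ = (\int[pker_probability (Defs.choice sigma) t]_m
     (a + b * high_price_prob high t m - c * high_price_prob low t m))%:E).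
  by rewrite (EFin_Rintegral measurableT hi).
by rewrite hE.
Qed.

Lemma choice_trade_prob t v : Theta t ->
  (\int[Defs.choice sigma t]_m trade_prob sigma t m v =
   (match v with low => 1 - ex_ante_high_price_prob low t | high => 1 end)%:E)%E.
Proof.
move=> Tt; case: v.
  transitivity (\int[Defs.choice sigma t]_m (1 + 0 * high_price_prob high t m
      - 1 * high_price_prob low t m)%:E)%E.
    by apply: eq_integral => m _; rewrite trade_probE//; congr EFin; ring.
  by rewrite choice_affine//; congr EFin; ring.
  transitivity (\int[Defs.choice sigma t]_m (1 + 0 * high_price_prob high t m
      - 0 * high_price_prob low t m)%:E)%E.
    by apply: eq_integral => m _; rewrite trade_probE//; congr EFin; ring.
  by rewrite choice_affine//; congr EFin; ring.
Qed.

Lemma choice_payment t v : Theta t ->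
  (\int[Defs.choice sigma t]_m payment sigma t m v =
   (match v with
    | low => L * (1 - ex_ante_high_price_prob low t)
    | high => L + (H - L) * ex_ante_high_price_prob high t end)%:E)%E.
Proof.
move=> Tt; case: v.
  transitivity (\int[Defs.choice sigma t]_m (L + 0 * high_price_prob high t m
      - L * high_price_prob low t m)%:E)%E.
    by apply: eq_integral => m _; rewrite paymentE//; congr EFin; ring.
  by rewrite choice_affine//; congr EFin; ring.
  transitivity (\int[Defs.choice sigma t]_m (L + (H - L) * high_price_prob high t m
      - 0 * high_price_prob low t m)%:E)%E.
    by apply: eq_integral => m _; rewrite paymentE//; congr EFin; ring.
  by rewrite choice_affine//; congr EFin; ring.
Qed.

Definition ex_ante_profit t : R :=
  L + t * (H - L) * ex_ante_high_price_prob high t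
    - (1 - t) * L * ex_ante_high_price_prob low t.

Lemma choice_profit t : Theta t ->
  (\int[Defs.choice sigma t]_m signal_profit sigma t m = (ex_ante_profit t)%:E)%E.
Proof.
move=> Tt; rewrite /ex_ante_profit -choice_affine//.
by apply: eq_integral => m _; rewrite signal_profitE.
Qed.

Let pchoice_integrable t (a b c : R) : Theta t ->
  (pker_probability (Defs.choice sigma) t).-integrable setT
    (EFin \o (fun m => a + b * high_price_prob high t m - c * high_price_prob low t m)).
Proof.
move=> Tt; have [hi _] := @probability_Rintegral_affine2 _ _ _
  (pker_probability (Defs.choice sigma) t) _ _ a b c
  (measurable_high_price_prob high Tt) (high_price_prob01 high t)
  (measurable_high_price_prob low Tt) (high_price_prob01 low t).
exact: hi.
Qed.

Let cst_integrable t (a : R) :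
  (pker_probability (Defs.choice sigma) t).-integrable setT (EFin \o cst a).
Proof. exact: (@probability_bounded_integrable _ _ _ _ _ `|a|). Qed.

(** Type [t] keeps her choice of signal but ignores the realization. The values 0 and 1 of [c] give
    the comparison with always charging [L] and always charging [H]. *)
Lemma ex_ante_profit_ge (c : R) t : Theta t -> 0 <= c <= 1 ->
  L + t * (H - L) * c - (1 - t) * L * c <= ex_ante_profit t.
Proof.
move=> Tt c01; rewrite -lee_fin /ex_ante_profit -choice_affine//.
set a := (X in (X%:E <= _)%E).
have -> : a%:E = (\int[pker_probability (Defs.choice sigma) t]_m a%:E)%E.
  by rewrite integral_cst//= probability_setT mule1.
apply: (@le_integral _ _ _ (pker_probability (Defs.choice sigma) t)) => //.
- exact: cst_integrable.
- exact: pchoice_integrable.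
move=> m _; rewrite lee_fin.
have := @best_reply_profit t m (cst c) Tt (measurable_cst _) (fun=> c01).
by rewrite !probability_Rintegral_cst.
Qed.

(** A double deviation: [t] draws a signal as [t'] would and then prices as [t'] would. After each
    signal [m], her own pricing does at least as well by [best_reply_profit], and her equilibrium
    choice does at least as well as [m]; averaging over the choice of [t'] concludes. *)
Lemma ex_ante_incentive t t' : Theta t -> Theta t' ->
  L + t * (H - L) * ex_ante_high_price_prob high t'
    - (1 - t) * L * ex_ante_high_price_prob low t' <= ex_ante_profit t.
Proof.
move=> Tt Tt'; rewrite -lee_fin -choice_affine//.
have -> : (ex_ante_profit t)%:E =
    (\int[pker_probability (Defs.choice sigma) t']_m (ex_ante_profit t)%:E)%E.
  by rewrite integral_cst//= probability_setT mule1.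
apply: (@le_integral _ _ _ (pker_probability (Defs.choice sigma) t')) => //.
- exact: pchoice_integrable.
- exact: cst_integrable.
move=> m _; rewrite lee_fin.
have [_ _ _ + _] := sigma_eq; move=> /(_ t m Tt).
rewrite choice_profit// signal_profitE// lee_fin; apply: le_trans.
have mw : measurable_fun setT (fun s => fine (pricing sigma m (t', s) [set H])).
  exact: measurable_high_price.
exact: (@best_reply_profit t m _ Tt mw (@high_price01 t' m)).
Qed.

End equilibrium_outcome.

(** * The single signal *)

(** The threshold [g t] is the [beta(t)] of the overview. The conjugate [A] has supergradient [x u]
    at [u] and [t] at [g t]; adding the two inequalities gives [0 <= (t - x u) * (g t - u)], which
    orders [x u] and [t] on either side of the threshold. *)
Lemma indifferent_type (R : realType) (L H : R) (Theta : set R)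
    (q : value -> R -> R) : 0 < L -> L < H ->
  Theta `<=` [set t | 0 <= t <= 1] ->
  (forall v t, Theta t -> 0 <= q v t <= 1) ->
  (forall t t', Theta t -> Theta t' ->
    L + t * (H - L) * q high t' - (1 - t) * L * q low t' <=
    L + t * (H - L) * q high t - (1 - t) * L * q low t) ->
  (forall c t, Theta t -> 0 <= c <= 1 ->
    L + t * (H - L) * c - (1 - t) * L * c <=
    L + t * (H - L) * q high t - (1 - t) * L * q low t) ->
  exists x : R -> R, let g t := (H - L) * q high t + L * q low t in
    [/\ (forall u, 0 <= x u <= 1), {homo x : u v / u <= v},
        (forall t u, Theta t -> u < g t -> x u <= t),
        (forall t u, Theta t -> g t < u -> t <= x u) &
        (forall t, Theta t ->
          \int[lebesgue_measure]_(u in `[0, g t[) x u = L * q low t) /\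
        \int[lebesgue_measure]_(u in `[0, H[) x u = L].
Proof.
move=> L0 LH Theta01 q01 IC IR.
(* Profit of type [t] imitating [t'] is [a' + t * b']; the extreme types [0] and
   [1] are added, always charging [L] and always charging [H] respectively. *)
pose P t a b := [\/ [/\ Theta t, a = L - L * q low t &
                        b = (H - L) * q high t + L * q low t],
                    [/\ t = 0, a = L & b = 0] | [/\ t = 1, a = 0 & b = H]].
have P0 : P 0 L 0 by apply: Or32.
have P1 : P 1 0 H by apply: Or33.
have Pq t : Theta t -> P t (L - L * q low t) ((H - L) * q high t + L * q low t).
  by move=> Tt; apply: Or31.
have H0 : 0 < H by exact: lt_trans LH.
have qL t : Theta t -> 0 <= L * q low t <= L.
  by move=> Tt; have /andP[? ?] := q01 low t Tt; rewrite mulr_ge0 ?ler_piMr// ltW.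
have qH t : Theta t -> 0 <= (H - L) * q high t <= H - L.
  by move=> Tt; have /andP[? ?] := q01 high t Tt; rewrite mulr_ge0 ?ler_piMr// subr_ge0 ltW.
have P01 t a b : P t a b -> 0 <= t <= 1.
  by case=> [[/Theta01//]|[-> _ _]|[-> _ _]]; rewrite ?lexx ler01.
have PIC t a b t' a' b' : P t a b -> P t' a' b' -> a' + t * b' <= a + t * b.
  (* If the imitator is an added extreme type, the bounds on [q] suffice. For an imitator in [Theta]
     the three remaining cases are [IC], [IR] at 0 and [IR] at 1. *)
  move=> [[Tt -> ->]|[-> -> ->]|[-> -> ->]] [[Tt' -> ->]|[_ -> ->]|[_ -> ->]];
    try by (try have /andP[? ?] := qL _ Tt'; try have /andP[? ?] := qH _ Tt'; lra).
  - have := IC _ _ Tt Tt'; lra.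
  - have := IR 0 t Tt; rewrite lexx ler01 => /(_ isT); lra.
  - have := IR 1 t Tt; rewrite lexx ler01 => /(_ isT); lra.
have [A [x [x01 Ax AP Agrad]]] :=
  @support_lines_envelope R P (ex_intro _ 0 (ex_intro _ L (ex_intro _ 0 P0))) P01 PIC.
(* The added type 0 pins down [A 0 = L]; below, the added type 1 gives [A H = 0] and hence the total
   integral [L]. *)
have xint b : 0 <= b -> \int[lebesgue_measure]_(u in `[0, b[) x u = L - A b.
  by move=> b0; rewrite (supergradient_Rintegral x01 Ax b0) (AP _ _ _ P0).
exists x => /=; split.
- exact: x01.
- exact: supergradient_nondecreasing Ax.
- move=> t u Tt ug.
  have := Ax u ((H - L) * q high t + L * q low t).
  rewrite (AP _ _ _ (Pq _ Tt)); have := Agrad _ _ _ (Pq _ Tt) u.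
  set g := (H - L) * _ + _ in ug *; set a := L - _ => h1 h2.
  have : 0 <= (t - x u) * (g - u) by lra.
  by rewrite pmulr_lge0 ?subr_gt0// subr_ge0.
- move=> t u Tt gu.
  have := Ax u ((H - L) * q high t + L * q low t).
  rewrite (AP _ _ _ (Pq _ Tt)); have := Agrad _ _ _ (Pq _ Tt) u.
  set g := (H - L) * _ + _ in gu *; set a := L - _ => h1 h2.
  have : 0 <= (x u - t) * (u - g) by lra.
  by rewrite pmulr_lge0 ?subr_gt0// subr_ge0.
- split.
    move=> t Tt; rewrite xint ?(AP _ _ _ (Pq _ Tt)); first by lra.
    by have /andP[? ?] := qL t Tt; have /andP[? ?] := qH t Tt; lra.
  by rewrite xint ?(ltW H0)// (AP _ _ _ P1) subr0.
Qed.

Section screening_signal.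
Context (R : realType) (L H : R).
Hypotheses (L_gt0 : 0 < L) (ltLH : L < H).
Local Notation mu := (@lebesgue_measure R).
Variables (Theta : set (measurableTypeR R)) (q : value -> R -> R) (x : R -> R).
Let g (t : R) := (H - L) * q high t + L * q low t.
Hypothesis mTheta : measurable Theta.
Hypothesis Theta01 : Theta `<=` [set t : R | 0 <= t <= 1].
Hypothesis mq : forall v, measurable_fun Theta (q v).
Hypothesis q01 : forall v t, Theta t -> 0 <= q v t <= 1.
Hypothesis x01 : forall u, 0 <= x u <= 1.
Hypothesis x_nd : {homo x : u v / u <= v}.
Hypothesis x_le : forall t u, Theta t -> u < g t -> x u <= t.
Hypothesis x_ge : forall t u, Theta t -> g t < u -> t <= x u.
Hypothesis x_int : forall t, Theta t -> \int[mu]_(u in `[0, g t[) x u = L * q low t.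
Hypothesis x_total : \int[mu]_(u in `[0, H[) x u = L.

Let H_gt0 : 0 < H. Proof. exact: lt_trans ltLH. Qed.

Let g0H t : Theta t -> 0 <= g t <= H.
Proof.
move=> Tt; have /andP[h0 h1] := q01 high Tt; have /andP[l0 l1] := q01 low Tt.
have a1 : (H - L) * q high t <= H - L by rewrite ler_piMr// subr_ge0 ltW.
have a2 : L * q low t <= L by rewrite ler_piMr// ltW.
apply/andP; split; last by rewrite /g; lra.
by rewrite addr_ge0// mulr_ge0// ?subr_ge0 ltW.
Qed.

(* The weights solve [(1 - x) L low = x (H - L) high], which says that a seller
   of type [x u] has posterior [L / H] at [u]. *)
Let weight (v : value) (u : R) : R :=
  match v with low => x u / L | high => (1 - x u) / (H - L) end.

Let mx : measurable_fun [set: measurableTypeR R] x.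
Proof. exact: nondecreasing_measurable. Qed.

Let mweight v : measurable_fun [set: measurableTypeR R] (weight v).
Proof.
by case: v; apply: measurable_funM => //; apply: measurable_funB => //.
Qed.

Let weight_ge0 v u : 0 <= weight v u.
Proof.
have /andP[x0 x1] := x01 u.
by case: v => /=; rewrite divr_ge0// ?subr_ge0// ltW.
Qed.

Let itv_fin (b : R) : (mu `[0%R, b[%classic < +oo)%E.
Proof. by rewrite /= lebesgue_measure_itv/=; case: ifP => _; rewrite ?ltry. Qed.

Let x_integrable (b : R) : mu.-integrable `[0, b[ (EFin \o x).
Proof.
apply: (@bounded_integrable _ _ _ _ _ _ 1) => //.
- exact: itv_fin.
- exact: measurable_funTS.
- by move=> u _; have /andP[? ?] := x01 u; rewrite ger0_norm.
Qed.

Let cst_integrable (b c : R) : mu.-integrable `[0, b[ (EFin \o cst c).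
Proof. by apply: (@bounded_integrable _ _ _ _ _ _ `|c|) => //; exact: itv_fin. Qed.

Let weight_integrable v (b : R) : mu.-integrable `[0, b[ (EFin \o weight v).
Proof.
apply: (@bounded_integrable _ _ _ _ _ _ (L^-1 + (H - L)^-1)) => //.
- exact: itv_fin.
- exact: measurable_funTS.
move=> u _; rewrite ger0_norm//; have /andP[x0 x1] := x01 u.
have Li : 0 <= L^-1 by rewrite invr_ge0 ltW.
have Hi : 0 <= (H - L)^-1 by rewrite invr_ge0 subr_ge0 ltW.
have h1 : x u * L^-1 <= L^-1 by rewrite ler_piMl.
have h2 : (1 - x u) * (H - L)^-1 <= (H - L)^-1 by rewrite ler_piMl//; lra.
by case: v => /=; lra.
Qed.

Let weight_Rintegral v (b : R) : 0 <= b ->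
  \int[mu]_(u in `[0, b[) weight v u =
  match v with
  | low => (\int[mu]_(u in `[0, b[) x u) / L
  | high => (b - \int[mu]_(u in `[0, b[) x u) / (H - L) end.
Proof.
move=> b0; case: v => /=.
  by rewrite RintegralZr//; exact: x_integrable.
rewrite RintegralZr//.
  rewrite RintegralB//; last exact: cst_integrable.
  rewrite Rintegral_cst// /= lebesgue_measure_itv/= lte_fin.
  case: ltgtP b0 => // [b0 _|<- _]; rewrite ?mul1r ?mulr0//= subr0//.
exact: (integrableB _ (cst_integrable b 1) (x_integrable b)).
Qed.

(** The total [L] of the integral of [x] over [0, H] is exactly what normalizes both weights at
    once. *)
Let weight_total v : \int[mu]_(u in `[0, H[) weight v u = 1.
Proof.
by rewrite weight_Rintegral ?(ltW H_gt0)//; case: v => /=;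
  rewrite x_total divff// gt_eqF// subr_gt0.
Qed.

Let weight_threshold v t : Theta t -> \int[mu]_(u in `[0, g t[) weight v u = q v t.
Proof.
move=> Tt; have /andP[g0 gH] := g0H Tt.
rewrite weight_Rintegral//; case: v; rewrite x_int//.
  by rewrite mulrAC divff ?mul1r// gt_eqF.
by rewrite /g addrK mulrAC divff ?mul1r// gt_eqF// subr_gt0.
Qed.

Let dens v u : R := \1_(`[0, H[%classic : set R) u * weight v u.

Let mdens v : measurable_fun [set: measurableTypeR R] (dens v).
Proof.
by apply: measurable_funM => //; exact/measurable_indic/measurable_itv.
Qed.

Let dens_ge0 v u : 0 <= dens v u.
Proof. by rewrite mulr_ge0// indicE. Qed.

Let integral_dens_itv v (b : R) : 0 <= b <= H ->
  (\int[mu]_(u in `[0%R, b[) (dens v u)%:E)%E = (\int[mu]_(u in `[0, b[) weight v u)%:E.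
Proof.
move=> /andP[b0 bH]; rewrite EFin_Rintegral//.
apply: eq_integral => u; rewrite inE/= in_itv/= => /andP[u0 ub].
by rewrite /dens indicE mem_set ?mul1r//= in_itv/= u0 (lt_le_trans ub).
Qed.

Let integral_dens v : (\int[mu]_u (dens v u)%:E = 1)%E.
Proof.
rewrite -(weight_total v) -integral_dens_itv ?lexx ?(ltW H_gt0)//.
rewrite [RHS]integral_mkcond; apply: eq_integral => u _.
rewrite patchE; case: ifPn => // uH.
by rewrite /dens indicE (negbTE uH) mul0r.
Qed.

(* The second disjunct matters only at [s = g t], where [x s] may lie on either
   side of [t]; outside [Theta] the threshold is the junk value [0]. *)
Let high_price (t s : R) : bool := (s < (g \_ Theta) t) || (x s < t).

Let m_high_price :
  measurable_fun [set: measurableTypeR R * measurableTypeR R]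
    (fun ts => high_price ts.1 ts.2).
Proof.
have mg : measurable_fun [set: measurableTypeR R] (g \_ Theta).
  apply/(measurable_restrictT _ _).1 => //.
  by apply: measurable_funD; apply: measurable_funM => //; exact: mq.
apply: measurable_or; apply: measurable_fun_ltr => //.
- exact: (measurableT_comp mg).
- exact: (measurableT_comp mx).
Qed.

Let measurable_high_price_set t :
  measurable ([set s | high_price t s] : set (measurableTypeR R)).
Proof.
have := measurableT_comp m_high_price (pair1_measurable (t : measurableTypeR R)).
by move=> /(_ measurableT [set true]); rewrite setTI; apply.
Qed.

(** The set where [H] is charged differs from [0, g t[ only at negative points, where the density
    vanishes, and possibly at the null point [g t]; beyond it [x_ge] rules out the second
    disjunct. *)
Let integral_dens_high v t : Theta t ->
  (\int[mu]_(u in [set s | high_price t s]) (dens v u)%:E = (q v t)%:E)%E.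
Proof.
move=> Tt; have /andP[g0 gH] := g0H Tt.
rewrite -weight_threshold// -integral_dens_itv ?g0//.
rewrite [LHS]integral_mkcond [RHS]integral_mkcond.
have mS := measurable_high_price_set t.
apply: ae_eq_integral => //.
- apply/(measurable_restrictT _ _).1 => //; apply/measurable_EFinP.
  exact: measurable_funTS.
- apply/(measurable_restrictT _ _).1 => //; apply/measurable_EFinP.
  exact: measurable_funTS.
exists [set g t]; split => //; first exact: lebesgue_measure_set1.
move=> u /= /not_implyP[_] h; apply: contrapT => ug; apply: h.
have {}ug : u != g t by apply/eqP.
rewrite !patchE; case: ifPn => hS; case: ifPn => hI //.
- move: hS; rewrite inE/= /high_price patchE mem_set// => hS.
  move: hI; rewrite notin_setE/= in_itv/= => /negP; rewrite negb_and -!leNgt -ltNge.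
  case/orP => [u0|gu].
    rewrite /dens indicE memNset ?mul0r//= in_itv/= => /andP[+ _].
    by rewrite leNgt u0.
  move: hS; rewrite ltNge gu/= ltNge x_ge//.
  by rewrite lt_neqAle eq_sym ug.
- move: hS; rewrite notin_setE/= /high_price patchE mem_set//.
  move: hI; rewrite inE/= in_itv/= => /andP[_ ug'].
  by rewrite ug'.
Qed.

(** The denominator of Bayes' formula. It uses [weight] rather than [dens], so that the belief fits
    the price at every real [s], also outside [0, H[, as [optimal_pricing] demands. *)
Let total (t s : R) : R := t * weight high s + (1 - t) * weight low s.

(* Where both weighted likelihoods vanish, the belief [L / H] makes any price
   in [{L, H}] optimal. *)
Let posterior (t s : R) : R :=
  if total t s == 0 then L / H else t * weight high s / total t s.

Let LH01 : 0 <= L / H <= 1.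
Proof.
apply/andP; split; first by rewrite divr_ge0 ?ltW.
by rewrite ler_pdivrMr// mul1r ltW.
Qed.

Let total_ge0 t s : Theta t -> 0 <= total t s.
Proof.
move=> /Theta01 /andP[t0 t1].
by rewrite addr_ge0// mulr_ge0// subr_ge0.
Qed.

Let posterior_total t s : Theta t ->
  posterior t s * total t s = t * weight high s.
Proof.
move=> Tt; have /andP[t0 t1] := Theta01 Tt.
rewrite /posterior; case: eqVneq => [T0|Tn0]; last by rewrite divfK.
rewrite T0 mulr0; apply/esym/eqP; rewrite eq_le mulr_ge0// andbT -T0 lerDl.
by rewrite mulr_ge0// subr_ge0.
Qed.

Let posterior01 t s : Theta t -> 0 <= posterior t s <= 1.
Proof.
move=> Tt; have /andP[t0 t1] := Theta01 Tt; have T0 := total_ge0 s Tt.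
rewrite /posterior; case: eqVneq => // Tn0.
have T_gt0 : 0 < total t s by rewrite lt_neqAle eq_sym Tn0.
apply/andP; split; first by rewrite divr_ge0// mulr_ge0.
rewrite ler_pdivrMr// mul1r lerDl.
by rewrite mulr_ge0// subr_ge0.
Qed.

Let mposterior t : Theta t ->
  measurable_fun [set: measurableTypeR R] (posterior t : _ -> measurableTypeR R).
Proof.
move=> Tt.
have mT : measurable_fun [set: measurableTypeR R] (total t).
  by apply: measurable_funD; apply: measurable_funM => //; exact: mweight.
apply: measurable_fun_ifT => //.
  exact: measurable_fun_eqr.
(* The quotient is rewritten with the power -1, which is measurable and agrees with the inverse
   since [total] is nonnegative. *)
rewrite (_ : (fun s => _) = fun s => t * weight high s * (total t s `^ (-1))).
  apply: measurable_funM; first by apply: measurable_funM => //; exact: mweight.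
  exact: (measurableT_comp (@measurable_powR R (-1)) mT).
by apply/funext => s; rewrite powR_inv1// total_ge0.
Qed.

(** Multiplied by [total t s], the gain from charging [H] instead of [L] is
    [t * (1 - x s) - (1 - t) * x s], that is, [t - x s]. *)
Let posterior_threshold t s : Theta t ->
  (x s <= t -> L <= posterior t s * H) /\ (t <= x s -> posterior t s * H <= L).
Proof.
move=> Tt; rewrite /posterior; case: eqVneq => [_|Tn0].
  by rewrite divfK ?gt_eqF.
have Tgt0 : 0 < total t s by rewrite lt_neqAle eq_sym Tn0 total_ge0.
rewrite mulrAC ler_pdivlMr// ler_pdivrMr//.
have HL0 : H - L != 0 by rewrite gt_eqF// subr_gt0.
have -> : L * total t s = t * weight high s * H - (t - x s).
  rewrite /total /weight; field.
  by rewrite HL0 gt_eqF.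
by split; lra.
Qed.

Let high_price_threshold t s : Theta t ->
  if high_price t s then L <= posterior t s * H else posterior t s * H <= L.
Proof.
move=> Tt; have [lo hi] := posterior_threshold s Tt.
rewrite /high_price patchE mem_set//; case: ltP => /= [sg|gs].
  by apply: lo; exact: x_le.
by case: ltP => [/ltW/lo|/hi].
Qed.

Lemma screening_implementation : exists (I : signal R)
    (sigma : assessment (singleton_menu I)),
  equilibrium sigma L H Theta /\
  forall v t, Theta t -> ex_ante_high_price_prob H sigma v t = q v t.
Proof.
have [pi piE] := choice (fun v =>
  probability_of_density (mdens v) (dens_ge0 v) (integral_dens v)).
pose I := Signal (measurableTypeR R) pi.
pose price (ts : measurableTypeR R * measurableTypeR R) : measurableTypeR R :=
  if high_price ts.1 ts.2 then H else L.
have mprice : measurable_fun setT price by exact: measurable_fun_ifT.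
pose sigma : assessment (singleton_menu I) := @Assessment R (singleton_menu I)
  (kdirac (measurable_cst tt)) (fun _ => kdirac mprice) (fun _ => posterior)
  (fun v p => p <= buyer_value L H v).
have int_pi v (f : R -> R) (A : set (measurableTypeR R)) : measurable A ->
    measurable_fun [set: measurableTypeR R] f -> (forall s, 0 <= f s) ->
    (\int[pi v]_(s in A) (f s)%:E = \int[mu]_(s in A) (f s * dens v s)%:E)%E.
  move=> mA mf f0; rewrite integral_mkcond [RHS]integral_mkcond.
  rewrite (ge0_integral_density (mdens v) (dens_ge0 v) (piE v)).
  - by apply: eq_integral => s _; rewrite !patchE; case: ifP => // _; rewrite mul0e.
  - by apply/(measurable_restrictT _ _).1 => //; apply/measurable_EFinP;
      exact: measurable_funTS.
  - by move=> s; rewrite patchE; case: ifP => // _; rewrite lee_fin.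
have int_dirac d (T : measurableType d) (z : T) (f : T -> R) :
    measurable_fun setT f -> (\int[\d_z]_y (f y)%:E = (f z)%:E)%E.
  move=> mf; rewrite integral_dirac//; first by rewrite diracT mul1e.
  exact/measurable_EFinP.
have rho_measurable b : measurable_fun [set: measurableTypeR R]
    (price_profit sigma b).
  by apply: measurable_funD; apply: measurable_funM => //;
    exact: measurable_accepted_payment.
have eq_sigma : equilibrium sigma L H Theta.
  split.
  - move=> v A mA; apply: measurable_funTS.
    have mf : measurable_fun [set: (measurableTypeR R * unit) * measurableTypeR R]
        (fun z => (\1_A (price (z.1.1, z.2)))%:E : \bar R).
      apply/measurable_EFinP; apply: (measurableT_comp (measurable_indic mA)).
      apply: (measurableT_comp mprice); apply: measurable_fun_pair => //.
      exact: measurableT_comp.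
    have f0 (z : (measurableTypeR R * unit) * measurableTypeR R) :
        (0 <= ((\1_A (price (z.1.1, z.2)))%:E : \bar R))%E.
      by rewrite lee_fin.
    (* The price is deterministic given type and realization, so its distribution is a partial
       integral of a jointly measurable indicator. *)
    have := @measurable_fun_fubini_tonelli_F _ _
      (measurableTypeR R * unit)%type (measurableTypeR R) R (pi v) _ mf f0.
    apply: eq_measurable_fun => -[t []] _.
    by rewrite /fubini_F /price_dist; apply: eq_integral.
  - move=> t [] Tt; split; [exact: mposterior|by move=> s; exact: posterior01|].
    move=> A mA; have /andP[t0 t1] := Theta01 Tt.
    have p0 s : 0 <= posterior t s by case/andP: (posterior01 s Tt).
    have mp : measurable_fun [set: measurableTypeR R] (posterior t : _ -> R).
      exact: mposterior.
    have mpd v : measurable_fun A (fun s => (posterior t s * dens v s)%:E).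
      by apply/measurable_EFinP; apply: measurable_funTS; apply: measurable_funM.
    have pd0 v s : (0 <= (posterior t s * dens v s)%:E)%E by rewrite lee_fin mulr_ge0.
    have mdA v : measurable_fun A (fun s => (dens v s)%:E).
      by apply/measurable_EFinP; exact: measurable_funTS.
    have d0 v s : (0 <= (dens v s)%:E)%E by rewrite lee_fin.
    have t0' : (0 <= t%:E)%E by rewrite lee_fin.
    have t1' : (0 <= (1 - t)%:E)%E by rewrite lee_fin subr_ge0.
    rewrite !int_pi// piE//= -!ge0_integralZl//.
    rewrite -ge0_integralD//; last 4 first.
    - by move=> s _; rewrite mule_ge0.
    - exact: measurable_funeM.
    - by move=> s _; rewrite mule_ge0// lee_fin subr_ge0.
    - exact: measurable_funeM.
    apply: eq_integral => s _; rewrite -!EFinM -EFinD; congr EFin.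
    have := posterior_total s Tt; rewrite /total /dens => h.
    by rewrite [RHS]mulrCA -h; ring.
  - move=> t [] s p' Tt.
    rewrite [leRHS](int_dirac _ _ (price (t, s)) _ (rho_measurable _)) lee_fin.
    have /andP[p0 p1] := posterior01 s Tt.
    have := high_price_threshold s Tt.
    rewrite /price_profit /price /=; set b := posterior t s in p0 p1 *.
    (* In both cases a deviation earns at most [L] if everybody accepts it, at most [b * H] if only
       the high value does, and nothing otherwise. *)
    case: (high_price t s) => h; rewrite lexx;
      [rewrite (leNgt H L) ltLH/=|rewrite (ltW ltLH)].
      case: (leP p' L) => [p'L|_]; first by rewrite (le_trans p'L (ltW ltLH)) !mulr1; lra.
      rewrite !mulr0 !addr0 mulr1; case: (leP p' H) => [p'H|_].
        by rewrite mulr1 ler_wpM2l.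
      by rewrite !mulr0 mulr_ge0// ltW.
    case: (leP p' L) => [p'L|_]; first by rewrite (le_trans p'L (ltW ltLH)) !mulr1; lra.
    rewrite !mulr0 !addr0 !mulr1; case: (leP p' H) => [p'H|_]; last first.
      by rewrite !mulr0 -mulrDl addrC subrK mul1r ltW.
    have : b * p' <= b * H by rewrite ler_wpM2l.
    by rewrite mulr1; lra.
  - move=> t [] Tt.
    rewrite /= [leRHS](_ : _ = signal_profit sigma t tt)//.
    by rewrite integral_dirac// diracT mul1e.
  - move=> v p; split => [b|->]; last by rewrite /= lexx.
    rewrite /=; case: (leP p) => pv.
      rewrite mulr1; case: b; rewrite ?mulr1// mulr0 subr_ge0//.
    rewrite mulr0; case: b; rewrite ?mulr0// mulr1 subr_le0 ltW//.
exists I, sigma; split => // v t Tt.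
rewrite /ex_ante_high_price_prob [LHS](_ : _ = high_price_prob H sigma v t tt).
  rewrite /high_price_prob /Rintegral.
  have mS := measurable_high_price_set t.
  rewrite (_ : integral _ _ _ = (q v t)%:E)//.
  transitivity (\int[pi v]_s (\1_[set s | high_price t s] s)%:E)%E; last first.
    by rewrite integral_indic// setIT [LHS]piE// integral_dens_high.
  apply: eq_integral => s _; congr EFin.
  rewrite /kdirac /= indicE /dirac /= indicE; congr (nat_of_bool _)%:R.
  rewrite /price /=; case: ifPn => hs.
    by rewrite !mem_set.
  rewrite !memNset//=; first exact/negP.
  by apply/eqP; rewrite lt_eqF.
by rewrite /Rintegral int_dirac.
Qed.

End screening_signal.

Unset Implicit Arguments.

Theorem proposition2 (R : realType) (L H : R) (L_gt0 : 0 < L) (ltLH : L < H)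
  (Theta : set (measurableTypeR R)) (mTheta : measurable Theta)
  (Theta01 : Theta `<=` [set t : R | 0 <= t <= 1])
  (F : probability (measurableTypeR R) R) (F_Theta : F Theta = 1%E)
  (a : value -> R * R) (a_rule : allocation_rule a) :
  implementable L H Theta F a ->
  exists I : signal R, implements L H Theta F (singleton_menu I) a.
Proof.
move=> [M [sigma [sigma_eq sigma_a]]].
pose q := ex_ante_high_price_prob H sigma.
have q01 v t : Theta t -> 0 <= q v t <= 1.
  exact: (ex_ante_high_price_prob01 mTheta sigma_eq).
have IC := ex_ante_incentive L_gt0 ltLH mTheta Theta01 sigma_eq.
have IR := ex_ante_profit_ge L_gt0 ltLH mTheta Theta01 sigma_eq.
have [x [x01 x_nd x_le x_ge [x_int x_total]]] :=
  indifferent_type L_gt0 ltLH Theta01 q01 IC IR.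
have mq v : measurable_fun Theta (q v).
  exact: (measurable_ex_ante_high_price_prob mTheta sigma_eq).
have [I [tau [tau_eq tau_q]]] :=
  screening_implementation L_gt0 ltLH mTheta Theta01 mq q01 x01 x_nd x_le x_ge
    x_int x_total.
(* Both equilibria have the same [q] on [Theta], so the integrands for trade and payment agree type
   by type. *)
exists I, tau; split=> // v /=; have [trade pay] := sigma_a v.
split; [rewrite trade|rewrite pay]; apply: eq_integral => t /[!inE] Tt.
  rewrite (choice_trade_prob L_gt0 ltLH mTheta sigma_eq)//.
  rewrite (choice_trade_prob L_gt0 ltLH mTheta tau_eq)//.
  by case: v {trade pay} => //; rewrite tau_q.
rewrite (choice_payment L_gt0 ltLH mTheta sigma_eq)//.
rewrite (choice_payment L_gt0 ltLH mTheta tau_eq)//.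
by case: v {trade pay}; rewrite tau_q.
Qed.
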